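(* Let $Q$ be an inverse quantal frame. The sheaf homomorphisms of $Q$-sheaves coincide with the arrows of $\mathrm{Map}(Q\text{-}\mathbf{HMB})$; that is, if $X$ and $Y$ are $Q$-sheaves and $\varphi:\mathcal O(X)\to\mathcal O(Y)$ is a function, then $\varphi$ is a sheaf homomorphism if and only if it is a morphism of $\mathrm{Map}(Q\text{-}\mathbf{HMB})$.
   Context: An involutive quantale is a sup-lattice (complete lattice) $Q$ with an associative multiplication preserving arbitrary joins in each variable and a join-preserving involution $a\mapsto a^*$ with $a^{**}=a$, $(ab)^*=b^*a^*$; it is unital if the multiplication has a unit $e$. $1$ denotes a top element. A left $Q$-module (for $Q$ unital) is a sup-lattice $X$ with an associative, unital action $Q\times X\to X$ preserving joins in each variable; homomorphisms preserve joins and the action. Inverse quantal frames: a support on a unital involutive quantale $Q$ is a join-preserving map $\varsigma:Q\to Q$ with $\varsigma(a)\le e$, $\varsigma(a)\le aa^*$ and $a\le\varsigma(a)a$ for all $a$; it is stable if $\varsigma(ab)=\varsigma(a\varsigma(b))$ for all $a,b$. A stable quantal frame is a unital involutive quantale with a stable support whose underlying lattice is a frame. An inverse quantal frame is a stable quantal frame $Q$ with $\bigvee\{s\in Q\mid ss^*\vee s^*s\le e\}=1$. Its base locale is $B=\{b\in Q\mid b\le e\}$, a frame which is a unital subquantale of $Q$ with trivial involution and multiplication $bc=b\wedge c$. $Q$-sheaves: for a locale $X$, $\mathcal O(X)$ denotes the corresponding frame. A $Q$-locale is a locale $X$ with a left $Q$-module structure on $\mathcal O(X)$ such that $bx=b1\wedge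 x$ for all $b\in B$, $x\in\mathcal O(X)$. It is open if there is a (necessarily unique) homomorphism of $B$-modules $\varsigma:\mathcal O(X)\to B$ (the support) with $\varsigma(x)x=x$ for all $x$. A local section of an open $Q$-locale $X$ is an element $s\in\mathcal O(X)$ such that $x=\varsigma(x)s$ for all $x\le s$; $\Gamma_X$ is the set of local sections. A $Q$-sheaf is an open $Q$-locale $X$ with $\bigvee\Gamma_X=1$. A sheaf homomorphism from $X$ to $Y$ is a homomorphism of left $Q$-modules $h:\mathcal O(X)\to\mathcal O(Y)$ with $\varsigma(h(x))=\varsigma(x)$ for all $x\in\mathcal O(X)$ and $h(\Gamma_X)\subset\Gamma_Y$. Complete Hilbert modules: a pre-Hilbert $Q$-module is a left $Q$-module $X$ with an inner product $\langle-,-\rangle:X\times X\to Q$ satisfying $\langle ax,y\rangle=a\langle x,y\rangle$, $\langle\bigvee_i x_i,y\rangle=\bigvee_i\langle x_i,y\rangle$ and $\langle x,y\rangle=\langle y,x\rangle^*$; it is a Hilbert $Q$-module if moreover $\langle x,-\rangle=\langle y,-\rangle$ implies $x=y$. A Hilbert section is an element $s\in X$ such that $\langle x,s\rangle s\le x$ for all $x\in X$; a Hilbert module $X$ is complete if, for all $x\in X$, $x$ is the join of the elements $\langle x,s\rangle s$ with $s$ ranging over all the Hilbert sections. $Q\text{-}\mathbf{HMB}$ is the category of complete Hilbert $Q$-modules and homomorphisms of $Q$-modules; every such homomorphism $\varphi:X\to Y$ has a unique adjoint $\varphi^\dagger:Y\to X$ with $\langle\varphi(x),y\rangle=\langle x,\varphi^\dagger(y)\rangle$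 for all $x,y$. $\mathrm{Map}(Q\text{-}\mathbf{HMB})$ has the same objects, and its morphisms are the homomorphisms $\varphi:X\to Y$ with $\varphi\varphi^\dagger\le\mathrm{id}_Y$ and $\varphi^\dagger\varphi\ge\mathrm{id}_X$ (pointwise order). Identification used: for an inverse quantal frame $Q$, a left $Q$-module is a complete Hilbert $Q$-module with respect to at most one inner product, and the left $Q$-modules that admit such an inner product are exactly the modules $\mathcal O(X)$ of $Q$-sheaves $X$. Each $\mathcal O(X)$ is regarded as a complete Hilbert $Q$-module with respect to this unique inner product. *)

(* Defs.v *)
From HB Require Import structures.
From mathcomp Require Import all_boot all_order.
From mathcomp Require Import boolp classical_sets.

Set Implicit Arguments.
Unset Strict Implicit.
Unset Printing Implicit Defensive.

Import Order.TTheory.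

Local Open Scope classical_set_scope.
Local Open Scope order_scope.

(* Sup-lattices. The order is a MathComp order, so carriers are choice types;
   classically this is no restriction. The finite lattice operations of
   tbLatticeType are determined by the order, hence are no extra data. *)

HB.mixin Record TBLattice_isSupLattice d T of Order.TBLattice d T := {
  joins : set T -> T;
  joinsP : forall A : set T, supremums A (joins A)
}.

#[short(type="supLatticeType")]
HB.structure Definition SupLattice (d : Order.disp_t) :=
  {T of TBLattice_isSupLattice d T & Order.TBLattice d T}.

Definition preserves_joins d d' (T : supLatticeType d) (T' : supLatticeType d')
    (f : T -> T') : Prop :=
  forall A : set T, f (joins A) = joins (f @` A).

HB.mixin Record SupLattice_isFrame d T of SupLattice d T := {
  meet_joins : forall (x : T) (A : set T),
    x `&` joins A = joins [set x `&` a | a in A]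
}.

#[short(type="frameType")]
HB.structure Definition Frame (d : Order.disp_t) :=
  {T of SupLattice_isFrame d T & SupLattice d T}.

(* Unital involutive quantales: the multiplication, its unit e (written 1)
   and the involution are those of MathComp's *-monoids, where the involution
   is called inv. The top element is \top. *)


Declare Scope quantale_scope.
Delimit Scope quantale_scope with Q.
Local Open Scope quantale_scope.

Notation "a ^*" := (inv a) : quantale_scope.
Notation "a * b" := (mul a b) : quantale_scope.
Notation "1" := (@monoid.one _) : quantale_scope.

HB.mixin Record isUnitalInvolutiveQuantale d Q
    of SupLattice d Q & StarMonoid Q := {
  mul_joinsl : forall b : Q, preserves_joins (fun a : Q => a * b);
  mul_joinsr : forall a : Q, preserves_joins (fun b : Q => a * b);
  star_joins : preserves_joins (fun a : Q => a^*)
}.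

#[short(type="uiQuantaleType")]
HB.structure Definition UnitalInvolutiveQuantale (d : Order.disp_t) :=
  {Q of isUnitalInvolutiveQuantale d Q & SupLattice d Q & StarMonoid Q}.

HB.mixin Record hasStableSupport d Q of UnitalInvolutiveQuantale d Q := {
  qsupp : Q -> Q;
  qsupp_joins : preserves_joins qsupp;
  qsupp_le1 : forall a : Q, qsupp a <= 1;
  qsupp_le_mul_star : forall a : Q, qsupp a <= a * a^*;
  le_qsupp_mul : forall a : Q, a <= qsupp a * a;
  qsupp_stable : forall a b : Q, qsupp (a * b) = qsupp (a * qsupp b)
}.

#[short(type="stableQuantalFrameType")]
HB.structure Definition StableQuantalFrame (d : Order.disp_t) :=
  {Q of hasStableSupport d Q & UnitalInvolutiveQuantale d Q & Frame d Q}.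

HB.mixin Record isInverseQuantalFrame d Q of StableQuantalFrame d Q := {
  joins_partial_units :
    joins [set s : Q | (s * s^*) `|` (s^* * s) <= 1] = \top
}.

#[short(type="inverseQuantalFrameType")]
HB.structure Definition InverseQuantalFrame (d : Order.disp_t) :=
  {Q of isInverseQuantalFrame d Q & StableQuantalFrame d Q}.

HB.mixin Record isQModule dQ (Q : uiQuantaleType dQ) d X of SupLattice d X := {
  act : Q -> X -> X;
  act1 : forall x : X, act 1 x = x;
  actM : forall (a b : Q) (x : X), act (a * b) x = act a (act b x);
  act_joinsl : forall x : X, preserves_joins (fun a : Q => act a x);
  act_joinsr : forall a : Q, preserves_joins (act a)
}.

#[short(type="qModuleType")]
HB.structure Definition QModule dQ (Q : uiQuantaleType dQ) (d : Order.disp_t) :=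
  {X of isQModule dQ Q d X & SupLattice d X}.

Notation "a *: x" := (act a x) : quantale_scope.

Definition module_hom dQ (Q : uiQuantaleType dQ) dX dY
    (X : qModuleType Q dX) (Y : qModuleType Q dY) (h : X -> Y) : Prop :=
  preserves_joins h /\ forall (a : Q) (x : X), h (a *: x) = a *: h x.

(* A Q-locale is represented by its frame O(X). Elements of the base locale B
   are the b : Q with b <= 1; joins in B are joins in Q, so a homomorphism of
   B-modules O(X) -> B is a join-preserving map O(X) -> Q with values below 1
   that commutes with the action of such b. *)

HB.mixin Record isQLocale dQ (Q : uiQuantaleType dQ) d X
    of Frame d X & QModule dQ Q d X := {
  act_base : forall (b : Q) (x : X), b <= 1 -> b *: x = (b *: \top) `&` x
}.

#[short(type="qLocaleType")]
HB.structure Definition QLocale dQ (Q : uiQuantaleType dQ) (d : Order.disp_t) :=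
  {X of isQLocale dQ Q d X & Frame d X & QModule dQ Q d X}.

HB.mixin Record isOpenQLocale dQ (Q : uiQuantaleType dQ) d X
    of QLocale dQ Q d X := {
  supp : X -> Q;
  supp_le1 : forall x : X, supp x <= 1;
  supp_joins : preserves_joins supp;
  supp_act : forall (b : Q) (x : X), b <= 1 -> supp (b *: x) = b * supp x;
  supp_id : forall x : X, supp x *: x = x
}.

#[short(type="openQLocaleType")]
HB.structure Definition OpenQLocale dQ (Q : uiQuantaleType dQ)
    (d : Order.disp_t) :=
  {X of isOpenQLocale dQ Q d X & QLocale dQ Q d X}.

Definition local_sections dQ (Q : uiQuantaleType dQ) d
    (X : openQLocaleType Q d) : set X :=
  [set s | forall x : X, x <= s -> x = supp x *: s].

HB.mixin Record isQSheaf dQ (Q : uiQuantaleType dQ) d X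
    of OpenQLocale dQ Q d X := {
  joins_local_sections : joins (@local_sections dQ Q d X) = \top
}.

#[short(type="qSheafType")]
HB.structure Definition QSheaf dQ (Q : uiQuantaleType dQ) (d : Order.disp_t) :=
  {X of isQSheaf dQ Q d X & OpenQLocale dQ Q d X}.

Definition sheaf_hom dQ (Q : uiQuantaleType dQ) dX dY
    (X : qSheafType Q dX) (Y : qSheafType Q dY) (h : X -> Y) : Prop :=
  [/\ module_hom h,
      forall x : X, supp (h x) = supp x &
      h @` @local_sections _ Q _ X `<=` @local_sections _ Q _ Y].

Section HilbertModules.
Variables (dQ : Order.disp_t) (Q : uiQuantaleType dQ).

Section InnerProduct.
Variables (d : Order.disp_t) (X : qModuleType Q d) (ip : X -> X -> Q).

Definition pre_hilbert : Prop :=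
  [/\ forall (a : Q) (x y : X), ip (a *: x) y = a * ip x y,
      forall y : X, preserves_joins (fun x : X => ip x y) &
      forall x y : X, ip x y = (ip y x)^*].

Definition hilbert : Prop :=
  pre_hilbert /\
  forall x y : X, (forall z : X, ip x z = ip y z) -> x = y.

Definition hilbert_sections : set X :=
  [set s | forall x : X, ip x s *: s <= x].

Definition complete_hilbert : Prop :=
  hilbert /\
  forall x : X, x = joins [set ip x s *: s | s in hilbert_sections].

End InnerProduct.

(* The inner product making X a complete Hilbert module. Over an inverse
   quantal frame there is at most one, and there is one if X is a sheaf; the
   default value is only taken if there is none. *)
Definition inner_product d (X : qModuleType Q d) : X -> X -> Q :=
  xget (fun _ _ => \bot) [set ip | complete_hilbert ip].

Section Maps.
Variables (dX dY : Order.disp_t).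
Variables (X : qModuleType Q dX) (Y : qModuleType Q dY).

Definition adjoint (phi : X -> Y) (psi : Y -> X) : Prop :=
  forall (x : X) (y : Y), inner_product (phi x) y = inner_product x (psi y).

(* By nondegeneracy of the inner product of X, psi is unique. *)
Definition map_hmb (phi : X -> Y) : Prop :=
  module_hom phi /\
  exists psi : Y -> X,
    [/\ adjoint phi psi,
        forall y : Y, phi (psi y) <= y &
        forall x : X, x <= psi (phi x)].

End Maps.
End HilbertModules.

(* Main.v *)
Require Import Defs.
From mathcomp Require Import all_boot all_order.
From mathcomp Require Import boolp classical_sets.

Set Implicit Arguments.
Unset Strict Implicit.
Unset Printing Implicit Defensive.

Import Order.TTheory.

Local Open Scope classical_set_scope.
Local Open Scope order_scope.
Local Open Scope quantale_scope.

(** Both notions of morphism are governed by one dictionary between the lattice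
structure of a sheaf and its inner product: for any inner product ip that
makes a sheaf X a complete Hilbert module,
  - ip x y `&` 1 = supp (x `&` y)  ([ip_meet1_le], [supp_meet_le_ip]);
  - the Hilbert sections are exactly the local sections
    ([hilbert_sectionsE]).
Moreover such an inner product exists ([germ_product_complete]). Think of Q as
the topology of an etale groupoid and of X as an equivariant sheaf on its
space of units: the arrows g that send a point of y to a point of x form an
open set, which is the value at (x, y) of this inner product.

Given the dictionary, let phi be a sheaf homomorphism. The map psi that sends
y to the join of the ip y (phi s) *: s, for s a local section, is adjoint to
phi because x is the join of the ip x s *: s. Since phi s is again a Hilbert
section, phi (psi y) <= y. For a local section s <= x one has
supp s = supp (phi s) <= ip (phi x) (phi s), whence s <= psi (phi x).

Conversely let phi be a map with adjoint psi. Then supp (phi x) <= supp x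
because phi commutes with the action of supp x, and the other inequality
follows from supp x <= ip x x <= ip x (psi (phi x)) = ip (phi x) (phi x). If s
is a section, then ip y (phi s) *: phi s = phi (ip (psi y) s *: s)
<= phi (psi y) <= y, so phi s is a Hilbert section, hence a local section. *)

(** * Joins and join-preserving maps *)

Lemma joins_ub d (T : supLatticeType d) (A : set T) (x : T) :
  A x -> x <= joins A.
Proof. exact: (proj1 (Defs.joinsP A)). Qed.

Lemma joins_le d (T : supLatticeType d) (A : set T) (z : T) :
  (forall x, A x -> x <= z) -> joins A <= z.
Proof. exact: (proj2 (Defs.joinsP A)). Qed.

Section JoinPreservingMaps.
Variables (d d' : Order.disp_t) (T : supLatticeType d) (T' : supLatticeType d').
Implicit Types (A : set T) (f : T -> T').

Lemma preserves_joins_le f A z :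
  preserves_joins f -> (forall x, A x -> f x <= z) -> f (joins A) <= z.
Proof.
by move=> fJ Az; rewrite fJ; apply: joins_le => _ [x Ax <-]; exact: Az.
Qed.

Lemma preserves_joins_mono f x y : preserves_joins f -> x <= y -> f x <= f y.
Proof.
move=> fJ xy.
suff -> : y = joins [set x; y].
  by rewrite fJ; apply: joins_ub; exists x => //; left.
apply: le_anti; rewrite joins_ub /=; last by right.
by apply: joins_le => _ [->|->].
Qed.

End JoinPreservingMaps.

Lemma preserves_joins_comp d1 d2 d3 (T1 : supLatticeType d1)
    (T2 : supLatticeType d2) (T3 : supLatticeType d3) (f : T2 -> T3)
    (g : T1 -> T2) :
  preserves_joins f -> preserves_joins g -> preserves_joins (f \o g).
Proof. by move=> fJ gJ A /=; rewrite gJ fJ image_comp. Qed.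

Lemma meet_preserves_joins d (T : frameType d) (y : T) :
  preserves_joins (fun x : T => x `&` y).
Proof.
move=> A /=; rewrite meetC meet_joins; congr joins; apply: eq_imagel => x _.
by rewrite meetC.
Qed.

(** * The base locale and the partial units of an inverse quantal frame *)

Section Quantales.
Variables (d : Order.disp_t) (Q : uiQuantaleType d).
Implicit Types a b c : Q.

Lemma qmul_mono a b a' b' : a <= a' -> b <= b' -> a * b <= a' * b'.
Proof.
move=> aa' bb'; apply: (@le_trans _ _ (a' * b)).
  exact: (preserves_joins_mono (mul_joinsl b)).
exact: (preserves_joins_mono (mul_joinsr a')).
Qed.

Lemma star_mono a b : a <= b -> a^* <= b^*.
Proof. exact: (preserves_joins_mono star_joins). Qed.

Lemma star_le1 b : b <= 1 -> b^* <= 1.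
Proof. by move=> /star_mono; rewrite invg1. Qed.

Lemma mul_lel b a : b <= 1 -> b * a <= a.
Proof. by move=> b1; rewrite -[leRHS]mul1g qmul_mono. Qed.

Lemma mul_ler b a : b <= 1 -> a * b <= a.
Proof. by move=> b1; rewrite -[leRHS]mulg1 qmul_mono. Qed.

Lemma mul_le1 b c : b <= 1 -> c <= 1 -> b * c <= 1.
Proof. by move=> b1 c1; apply: le_trans c1; exact: mul_lel. Qed.

(** Partial units are the open bisections of the groupoid; conjugation by one
moves the base locale along its action. *)
Definition partial_unit : set Q := [set t | t * t^* <= 1 /\ t^* * t <= 1].

Lemma partial_unit1 : partial_unit 1.
Proof. by split; rewrite invg1 mul1g. Qed.

Lemma partial_unit_star t : partial_unit t -> partial_unit t^*.
Proof. by case=> t1 t2; split; rewrite invgK. Qed.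

Lemma partial_unit_le s t : partial_unit t -> s <= t -> partial_unit s.
Proof.
move=> [t1 t2] st; split; [apply: le_trans t1 | apply: le_trans t2];
  by rewrite qmul_mono ?star_mono.
Qed.

Lemma partial_unit_conj_le1 t b : partial_unit t -> b <= 1 -> t * b * t^* <= 1.
Proof. by case=> t1 _ b1; apply: le_trans t1; rewrite qmul_mono ?mul_ler. Qed.

Lemma partial_unitM s t :
  partial_unit s -> partial_unit t -> partial_unit (s * t).
Proof.
move=> us ut; split; rewrite invgM.
  have := partial_unit_conj_le1 us ut.1; by rewrite !mulgA.
have := partial_unit_conj_le1 (partial_unit_star ut) us.2.
by rewrite invgK !mulgA.
Qed.

End Quantales.

Arguments partial_unit {d Q} _.

Section StableQuantalFrames.
Variables (d : Order.disp_t) (Q : stableQuantalFrameType d).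
Implicit Types a b c t : Q.

Lemma qsupp_mono a b : a <= b -> qsupp a <= qsupp b.
Proof. exact: (preserves_joins_mono qsupp_joins). Qed.

Lemma qsupp_base b : b <= 1 -> qsupp b = b.
Proof.
move=> b1; apply: le_anti; apply/andP; split.
  exact: le_trans (qsupp_le_mul_star b) (mul_ler _ (star_le1 b1)).
exact: le_trans (le_qsupp_mul b) (mul_ler _ b1).
Qed.

Lemma star_base b : b <= 1 -> b^* = b.
Proof.
have le_star c : c <= 1 -> c <= c^*.
  move=> c1; rewrite -[leLHS]qsupp_base //.
  exact: le_trans (qsupp_le_mul_star c) (mul_lel _ c1).
move=> b1; apply: le_anti; rewrite le_star // andbT.
by rewrite -[leRHS]invgK le_star // star_le1.
Qed.

Lemma mul_base_idem b : b <= 1 -> b * b = b.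
Proof.
move=> b1; apply: le_anti; rewrite mul_lel //=.
by rewrite -{1}[b]qsupp_base // -{3}[b]star_base // qsupp_le_mul_star.
Qed.

Lemma mul_baseC b c : b <= 1 -> c <= 1 -> b * c = c * b.
Proof.
by move=> b1 c1; rewrite -[LHS]star_base ?mul_le1 // invgM !star_base.
Qed.

Lemma qsupp_base_mul_le b a : b <= 1 -> qsupp (b * a) <= b.
Proof.
move=> b1; rewrite qsupp_stable qsupp_base ?mul_le1 ?qsupp_le1 //.
by rewrite mul_ler ?qsupp_le1.
Qed.

Lemma partial_unit_regular t : partial_unit t -> t * t^* * t = t.
Proof.
move=> [t1 _]; apply: le_anti; rewrite mul_lel //=.
by apply: le_trans (le_qsupp_mul t) _; rewrite qmul_mono ?qsupp_le_mul_star.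
Qed.

(** An element of the base can be moved across a partial unit at the price of
conjugation; this replaces commutativity in the computations below. *)
Lemma partial_unit_baseC t b : partial_unit t -> b <= 1 ->
  t * b * t^* * t = t * b.
Proof.
move=> ut b1; rewrite -mulgA -mulgA (mul_baseC b1 ut.2) !mulgA.
by rewrite partial_unit_regular.
Qed.

End StableQuantalFrames.

Section InverseQuantalFrames.
Variables (d : Order.disp_t) (Q : inverseQuantalFrameType d).

(** By the frame law every a is the join of the partial units below it, so
an upper bound of a join-preserving map need only be checked on those. *)
Lemma le_by_partial_units d' (T : supLatticeType d') (f : Q -> T) (a : Q)
    (z : T) :
    preserves_joins f ->
    (forall t, partial_unit t -> t <= a -> f t <= z) ->
  f a <= z.
Proof.
move=> fJ fz; rewrite -[a]meetx1 -joins_partial_units meet_joins.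
apply: (preserves_joins_le fJ) => _ [t /= t1 <-]; apply: fz; last exact: leIl.
apply: (@partial_unit_le _ _ _ t); last exact: leIr.
by move: t1; rewrite leUx => /andP[].
Qed.

End InverseQuantalFrames.

(** * Local sections of a sheaf *)

Section Modules.
Variables (dQ : Order.disp_t) (Q : uiQuantaleType dQ).
Variables (d : Order.disp_t) (X : qModuleType Q d).

Lemma act_mono (a b : Q) (x y : X) : a <= b -> x <= y -> a *: x <= b *: y.
Proof.
move=> ab xy; apply: (@le_trans _ _ (b *: x)).
  exact: (preserves_joins_mono (act_joinsl x)).
exact: (preserves_joins_mono (act_joinsr b)).
Qed.

Lemma act_le (b : Q) (x : X) : b <= 1 -> b *: x <= x.
Proof. by move=> b1; rewrite -[leRHS]act1 act_mono. Qed.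

Lemma act_meet_le (a : Q) (x y : X) : a *: (x `&` y) <= a *: x `&` a *: y.
Proof. by rewrite lexI !act_mono ?leIl ?leIr. Qed.

End Modules.

Section OpenLocales.
Variables (dQ : Order.disp_t) (Q : inverseQuantalFrameType dQ).
Variables (d : Order.disp_t) (X : openQLocaleType Q d).
Implicit Types (x y s : X) (b t : Q).

Lemma act_base_meet b x y : b <= 1 -> b *: (x `&` y) = b *: x `&` y.
Proof. by move=> b1; rewrite act_base // meetA -act_base. Qed.

Lemma supp_mono x y : x <= y -> supp x <= supp y.
Proof. exact: (preserves_joins_mono supp_joins). Qed.

Lemma supp_le_base b x : b <= 1 -> b *: x = x -> supp x <= b.
Proof. by move=> b1 <-; rewrite supp_act // mul_ler ?supp_le1. Qed.

(** The lower bound on the support comes from acting back with t^*: the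
element t^* * c * t of the base, for c the support of t *: x, leaves
t^* *: (t *: x) fixed and hence dominates its support. *)
Lemma supp_act_partial_unit t x : partial_unit t ->
  supp (t *: x) = t * supp x * t^*.
Proof.
move=> ut; have tx1 := partial_unit_conj_le1 ut (supp_le1 x).
apply: le_anti; apply/andP; split.
  apply: supp_le_base => //.
  by rewrite -actM partial_unit_baseC ?supp_le1 // actM supp_id.
set c := supp (t *: x); have c1 : c <= 1 by exact: supp_le1.
have tct1 : t^* * c * t <= 1.
  by have := partial_unit_conj_le1 (partial_unit_star ut) c1; rewrite invgK.
have e : t^* * c * t * supp x = t^* * t * supp x.
  rewrite -(supp_act _ x tct1) -(supp_act _ x ut.2).
  by rewrite !actM supp_id.
have -> : t * supp x * t^* = t * t^* * c * (t * supp x * t^*).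
  rewrite !mulgA -[in RHS](mulgA t) -[in RHS](mulgA t) -[in RHS](mulgA t).
  by rewrite e !mulgA partial_unit_regular.
apply: le_trans (mul_ler _ tx1) _.
by apply: mul_lel; exact: ut.1.
Qed.

Lemma local_section_le s x : local_sections s -> x <= s -> local_sections x.
Proof.
move=> sL xs y yx; apply: le_anti; apply/andP; split.
  by rewrite -{1}[y]supp_id act_mono.
by rewrite {2}(sL y (le_trans yx xs)) act_mono.
Qed.

(** An x below t *: s satisfies x = t *: (t^* *: x), because its support lies
below t * t^*; and t^* *: x lies below the local section s, hence is a
restriction of s, which the action of t transports back. *)
Lemma local_section_act t s : partial_unit t -> local_sections s ->
  local_sections (t *: s).
Proof.
move=> ut sL x xts; have ut' := partial_unit_star ut.
have tt_supp : t * t^* * supp x = supp x.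
  have xtt : supp x <= t * t^*.
    apply: le_trans (supp_mono xts) _; rewrite supp_act_partial_unit //.
    by rewrite qmul_mono // mul_ler ?supp_le1.
  apply: le_anti; rewrite mul_lel ?ut.1 //=.
  by rewrite -{1}[supp x]mul_base_idem ?supp_le1 // qmul_mono.
have t'x : t^* *: x <= s.
  apply: le_trans (act_mono (lexx _) xts) _.
  by rewrite -actM act_le //; exact: ut.2.
rewrite -{1}[x]supp_id -tt_supp actM supp_id actM (sL _ t'x).
rewrite supp_act_partial_unit // invgK -!actM !mulgA.
by rewrite tt_supp.
Qed.

End OpenLocales.

(** * Complete Hilbert structures on a sheaf *)

Section Sheaves.
Variables (dQ : Order.disp_t) (Q : inverseQuantalFrameType dQ).
Variables (d : Order.disp_t) (X : qSheafType Q d).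
Implicit Types (x y z s : X) (a b t : Q).

(** As for partial units: local sections are closed downwards and cover X. *)
Lemma le_by_local_sections d' (T : supLatticeType d') (f : X -> T) x (z : T) :
    preserves_joins f ->
    (forall s, local_sections s -> s <= x -> f s <= z) ->
  f x <= z.
Proof.
move=> fJ fz; rewrite -[x]meetx1 -joins_local_sections meet_joins.
apply: (preserves_joins_le fJ) => _ [s sL <-]; apply: fz; last exact: leIl.
by apply: local_section_le sL _; exact: leIr.
Qed.

Lemma supp_act_le a x : supp (a *: x) <= qsupp a.
Proof.
apply: supp_le_base; first exact: qsupp_le1.
apply: le_anti; rewrite act_le ?qsupp_le1 //=.
by rewrite -actM act_mono ?le_qsupp_mul.
Qed.

Section CompleteHilbertStructure.
Variable ip : X -> X -> Q.
Hypothesis ip_complete : complete_hilbert ip.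

Lemma ip_act a x y : ip (a *: x) y = a * ip x y.
Proof. by case: ip_complete => -[[+ _ _] _] _; apply. Qed.

Lemma ip_joinsl y : preserves_joins (fun x => ip x y).
Proof. by case: ip_complete => -[[_ + _] _] _; apply. Qed.

Lemma ip_star x y : (ip x y)^* = ip y x.
Proof. by case: ip_complete => -[[_ _ ipC] _] _; rewrite -ipC. Qed.

Lemma ip_expand x : x = joins [set ip x s *: s | s in hilbert_sections ip].
Proof. by case: ip_complete => _; apply. Qed.

Lemma ip_actr a x y : ip x (a *: y) = ip x y * a^*.
Proof. by rewrite -ip_star ip_act invgM ip_star. Qed.

Lemma ip_joinsr x : preserves_joins (ip x).
Proof.
have -> : ip x = (fun a => a^*) \o (fun y => ip y x).
  by apply: funext => y /=; rewrite ip_star.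
by apply: preserves_joins_comp; [exact: star_joins | exact: ip_joinsl].
Qed.

Lemma ip_mono x y x' y' : x <= x' -> y <= y' -> ip x y <= ip x' y'.
Proof.
move=> xx' yy'; apply: (@le_trans _ _ (ip x' y)).
  exact: (preserves_joins_mono (ip_joinsl y)).
exact: (preserves_joins_mono (ip_joinsr x')).
Qed.

(** Write x as the join of the a *: s with a := ip x s and s a Hilbert section.
The support of a *: s is at most a * a^* = ip (a *: s) x, and a *: s <= x. *)
Lemma supp_le_ip x : supp x <= ip x x.
Proof.
rewrite {1}[x]ip_expand; apply: (preserves_joins_le supp_joins) => _ [s sH <-].
apply: le_trans (supp_act_le _ _) _.
apply: le_trans (qsupp_le_mul_star _) _.
by rewrite ip_star -ip_act ip_mono.
Qed.

Lemma supp_meet_le_ip x y : supp (x `&` y) <= ip x y.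
Proof. by apply: le_trans (supp_le_ip _) _; rewrite ip_mono ?leIl ?leIr. Qed.

Lemma hilbert_section_act t s : partial_unit t ->
  hilbert_sections ip s -> hilbert_sections ip (t *: s).
Proof.
move=> [_ t1] sH x; apply: le_trans (sH x).
by rewrite ip_actr -actM act_mono // -mulgA mul_ler.
Qed.

Lemma base_le_supp x y b : b <= 1 -> b <= ip x y -> b <= supp y.
Proof.
move=> b1 bxy.
rewrite -[leLHS]qsupp_base //.
apply: le_trans (qsupp_base_mul_le (ip y x) (supp_le1 y)); apply: qsupp_mono.
by rewrite -ip_act supp_id -[b]star_base // -ip_star star_mono.
Qed.

(** It is enough to treat y = t *: s with s a Hilbert section and t a partial
unit. Then y is a Hilbert section as well, and for b := ip x y `&` 1 the
element b *: y lies below both y and x, while its support is b. *)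
Lemma ip_meet1_le x y : ip x y `&` 1 <= supp (x `&` y).
Proof.
have meetJ := @meet_preserves_joins _ Q 1.
rewrite {1}[y]ip_expand.
apply: (preserves_joins_le (preserves_joins_comp meetJ (ip_joinsr x))).
move=> _ [s sH <-] /=.
pose f a := ip x (a *: s) `&` 1.
apply: (@le_by_partial_units _ _ _ _ f).
  apply: (preserves_joins_comp meetJ).
  exact: (preserves_joins_comp (ip_joinsr x) (act_joinsl s)).
move=> t ut t_le; rewrite /f; set b := _ `&` _.
have b1 : b <= 1 by exact: leIr.
have bx : b <= ip x (t *: s) by exact: leIl.
have -> : b = supp (b *: (t *: s)).
  rewrite supp_act //; apply: le_anti; rewrite mul_ler ?supp_le1 // andbT.
  by rewrite -{1}[b]mul_base_idem // qmul_mono // (base_le_supp b1 bx).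
apply: supp_mono; rewrite lexI; apply/andP; split.
  apply: le_trans (hilbert_section_act ut sH x).
  by rewrite act_mono.
apply: le_trans (act_le _ b1) _; apply: le_trans (sH y).
by rewrite act_mono.
Qed.

Lemma base_le_supp_meet x y b : b <= 1 -> b <= ip x y -> b <= supp (x `&` y).
Proof. by move=> b1 bxy; apply: le_trans (ip_meet1_le x y); rewrite lexI bxy. Qed.

(** If s is a Hilbert section and x <= s, then supp x <= ip x x <= ip x s, so
that supp x *: s <= x. For a local section s and a partial unit
t <= ip x s, the idempotent t * t^* lies below ip x (t *: s), hence below
supp (x `&` t *: s); since t *: s is a local section, this forces
t *: s <= x. *)
Lemma hilbert_sectionsE : hilbert_sections ip = local_sections (X := X).
Proof.
apply/seteqP; split=> s sH.
  move=> x xs; apply: le_anti; apply/andP; split.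
    by rewrite -{1}[x]supp_id act_mono.
  apply: le_trans (sH x); rewrite act_mono //.
  by apply: le_trans (supp_le_ip x) _; rewrite ip_mono.
move=> x; apply: (@le_by_partial_units _ _ _ _ (fun a => a *: s)).
  exact: act_joinsl.
move=> t ut t_le; apply: le_trans (leIl x (t *: s)).
rewrite [leRHS](local_section_act ut sH (leIr _ _)).
rewrite -{1}(partial_unit_regular ut) actM act_mono //.
by apply: base_le_supp_meet; [exact: ut.1 | rewrite ip_actr qmul_mono].
Qed.

End CompleteHilbertStructure.

(** In the groupoid picture supp (x `&` t *: y) is the set of base points over
which the bisection t sends a point of y to a point of x; multiplying it by t
gives the arrows of t that do so, and every arrow lies in some bisection. *)
Definition germ_product x y : Q :=
  joins [set supp (x `&` t *: y) * t | t in partial_unit].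

Lemma le_germ_product t x y : partial_unit t ->
  supp (x `&` t *: y) * t <= germ_product x y.
Proof. by move=> ut; apply: joins_ub; exists t. Qed.

Lemma supp_meet_le_germ_product x y : supp (x `&` y) <= germ_product x y.
Proof.
have := le_germ_product x y (@partial_unit1 _ Q).
by rewrite act1 mulg1.
Qed.

Lemma germ_product_joins y : preserves_joins (fun x => germ_product x y).
Proof.
have termJ t : preserves_joins (fun x : X => supp (x `&` t *: y) * t).
  apply: (preserves_joins_comp (mul_joinsl t)).
  exact: (preserves_joins_comp supp_joins (@meet_preserves_joins _ X _)).
move=> A; apply: le_anti; apply/andP; split.
  apply: joins_le => _ [t ut <-]; apply: (preserves_joins_le (termJ t)) => x Ax.
  by apply: le_trans (le_germ_product x y ut) _; apply: joins_ub; exists x.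
apply: joins_le => _ [x Ax <-]; apply: joins_le => _ [t ut <-].
apply: le_trans (le_germ_product _ _ ut).
by apply: (preserves_joins_mono (termJ t)); exact: joins_ub.
Qed.

Lemma germ_product_base b x y : b <= 1 ->
  germ_product (b *: x) y = b * germ_product x y.
Proof.
move=> b1; rewrite /germ_product mul_joinsr image_comp; congr joins.
by apply: eq_imagel => t ut /=; rewrite -act_base_meet // supp_act // mulgA.
Qed.

(** The involution exchanges the terms for t and t^*: moving
b := supp (x `&` t *: y) across t^* gives the support of t^* *: (x `&` t *: y),
which lies below y `&` t^* *: x. *)
Lemma germ_product_star x y : (germ_product x y)^* = germ_product y x.
Proof.
have star_le x' y' : (germ_product x' y')^* <= germ_product y' x'.
  apply: (preserves_joins_le star_joins) => _ [t ut <-].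
  have ut' := partial_unit_star ut.
  set b := supp _; have b1 : b <= 1 by exact: supp_le1.
  apply: le_trans (le_germ_product y' x' ut').
  rewrite invgM (star_base b1) -(partial_unit_baseC ut' b1).
  rewrite -supp_act_partial_unit // qmul_mono // supp_mono //.
  apply: le_trans (act_meet_le _ _ _) _; rewrite meetC leI2 //.
  by rewrite -actM act_le //; exact: ut.2.
by apply: le_anti; rewrite star_le /= -{1}[germ_product y x]invgK star_mono.
Qed.

(** For a partial unit t, multiplying by t on the left sends the term for s below
the term for t * s, which gives t * germ_product x y <= germ_product (t *: x) y.
The reverse inequality follows by applying this one to t^* and t *: x, since
t *: x is unchanged by the action of t * t^*. *)
Lemma germ_product_act a x y : germ_product (a *: x) y = a * germ_product x y.
Proof.
have ge t x' : partial_unit t ->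
    t * germ_product x' y <= germ_product (t *: x') y.
  move=> ut; apply: (preserves_joins_le (mul_joinsr t)) => _ [s us <-].
  set b := supp _; have b1 : b <= 1 by exact: supp_le1.
  apply: le_trans (le_germ_product _ _ (partial_unitM ut us)).
  rewrite !mulgA -(partial_unit_baseC ut b1) -supp_act_partial_unit //.
  rewrite -!mulgA qmul_mono // actM.
  by rewrite supp_mono // act_meet_le.
apply: le_anti; apply/andP; split.
  apply: (@le_by_partial_units _ _ _ _ (fun a => germ_product (a *: x) y)).
    exact: (preserves_joins_comp (germ_product_joins y) (act_joinsl x)).
  (* Insert t * t^* in front of t *: x, then apply the inequality to t^*. *)
  move=> t ut ta; have ut' := partial_unit_star ut.
  rewrite -{1}(partial_unit_regular ut) !actM -actM.
  rewrite germ_product_base; last exact: ut.1.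
  apply: le_trans (qmul_mono ta (lexx _)).
  rewrite -mulgA qmul_mono //; apply: le_trans (ge _ _ ut') _.
  by rewrite -actM germ_product_base ?mul_lel ?ut.2.
apply: (@le_by_partial_units _ _ _ _ (fun a => a * germ_product x y)).
  exact: mul_joinsl.
move=> t ut ta; apply: le_trans (ge _ _ ut) _.
apply: (preserves_joins_mono (germ_product_joins y)).
by rewrite act_mono.
Qed.

(** Each term of the product acts on s as the restriction of the local section
t *: s to x `&` t *: s. *)
Lemma germ_product_section x s : local_sections s -> germ_product x s *: s <= x.
Proof.
move=> sL; apply: (preserves_joins_le (act_joinsl s)) => _ [t ut <-].
rewrite actM -(local_section_act ut sL (leIr _ _)); exact: leIl.
Qed.

Lemma germ_product_expand x :
  x = joins [set germ_product x s *: s | s in hilbert_sections germ_product].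
Proof.
apply: le_anti; apply/andP; split; last first.
  by apply: joins_le => _ [s sH <-].
apply: (@le_by_local_sections _ _ id) => [A|s sL sx]; first by rewrite image_id.
apply: (@le_trans _ _ (germ_product x s *: s)); last first.
  by apply: joins_ub; exists s => // y; exact: germ_product_section.
rewrite -{1}[s]supp_id act_mono //.
by apply: le_trans (supp_meet_le_germ_product x s); rewrite meet_r.
Qed.

Lemma germ_product_complete : complete_hilbert germ_product.
Proof.
split; last exact: germ_product_expand.
split; first by split=> [||x y]; [exact: germ_product_act
  | exact: germ_product_joins | rewrite germ_product_star].
move=> x y xy; rewrite [x]germ_product_expand [y]germ_product_expand.
by congr joins; apply: eq_imagel => s _; rewrite xy.
Qed.

Lemma inner_product_complete : complete_hilbert (@inner_product _ Q _ X).
Proof. by apply: xgetPex; exists germ_product; exact: germ_product_complete. Qed.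

Lemma inner_product_expand x :
  x = joins [set inner_product x s *: s | s in local_sections (X := X)].
Proof.
rewrite -(hilbert_sectionsE inner_product_complete).
exact: (ip_expand inner_product_complete).
Qed.

Lemma inner_product_section x s :
  local_sections s -> inner_product x s *: s <= x.
Proof. by rewrite -(hilbert_sectionsE inner_product_complete); apply. Qed.

End Sheaves.

(** * Sheaf homomorphisms and maps *)

Section SheafHomomorphisms.
Variables (dQ dX dY : Order.disp_t) (Q : inverseQuantalFrameType dQ).
Variables (X : qSheafType Q dX) (Y : qSheafType Q dY) (phi : X -> Y).

Lemma module_hom_supp_le x : module_hom phi -> supp (phi x) <= supp x.
Proof.
move=> [_ phiA]; apply: supp_le_base; first exact: supp_le1.
by rewrite -phiA supp_id.
Qed.

(** This formula for the adjoint is forced: by completeness of X the adjoint at y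
is the join of the inner_product (psi y) s *: s, and inner_product (psi y) s
must equal inner_product y (phi s). *)
Definition section_adjoint (y : Y) : X :=
  joins [set inner_product y (phi s) *: s | s in local_sections (X := X)].

Lemma section_adjointP : module_hom phi -> adjoint phi section_adjoint.
Proof.
move=> [phiJ phiA] x y.
have cX := inner_product_complete X; have cY := inner_product_complete Y.
rewrite [x in LHS]inner_product_expand phiJ (ip_joinsl cY) (ip_joinsr cX).
rewrite !image_comp; congr joins; apply: eq_imagel => s _ /=.
by rewrite phiA (ip_act cY) (ip_actr cX) (ip_star cY).
Qed.

Lemma sheaf_hom_map : sheaf_hom phi -> map_hmb phi.
Proof.
move=> [phiH phi_supp phi_loc]; have [phiJ phiA] := phiH.
split=> //; exists section_adjoint; split; first exact: section_adjointP.
  move=> y; apply: (preserves_joins_le phiJ) => _ [s sL <-].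
  by rewrite phiA inner_product_section //; apply: phi_loc; exists s.
move=> x; apply: (@le_by_local_sections _ _ _ _ _ _ id) => [A|s sL sx].
  by rewrite image_id.
apply: (@le_trans _ _ (inner_product (phi x) (phi s) *: s)); last first.
  by apply: joins_ub; exists s.
rewrite -{1}[s]supp_id act_mono // -phi_supp.
apply: le_trans (supp_meet_le_ip (inner_product_complete Y) _ _).
by rewrite meet_r // (preserves_joins_mono phiJ).
Qed.

Lemma map_sheaf_hom : map_hmb phi -> sheaf_hom phi.
Proof.
move=> [phiH [psi [adj phipsi psiphi]]]; have [phiJ phiA] := phiH.
have cX := inner_product_complete X; have cY := inner_product_complete Y.
split=> // [x|_ [s sL <-]].
  apply: le_anti; rewrite module_hom_supp_le //=.
  rewrite -[phi x in leRHS]meetxx (base_le_supp_meet cY) ?supp_le1 //.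
  by rewrite adj; apply: le_trans (supp_le_ip cX x) _; rewrite (ip_mono cX).
rewrite -(hilbert_sectionsE cY) => y.
rewrite -phiA -(ip_star cY) adj (ip_star cX).
apply: le_trans (phipsi y); apply: (preserves_joins_mono phiJ).
exact: inner_product_section.
Qed.

End SheafHomomorphisms.

Theorem lemma4p61 (dQ dX dY : Order.disp_t) (Q : inverseQuantalFrameType dQ)
    (X : qSheafType Q dX) (Y : qSheafType Q dY) (phi : X -> Y) :
  sheaf_hom phi <-> map_hmb phi.
Proof. by split; [exact: sheaf_hom_map | exact: map_sheaf_hom]. Qed.
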